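(* Let $X, Y$ be finite dimensional Euclidean spaces, $A: X \to Y$ a linear map, $b \in Y$, and $K \subseteq Y$ a closed convex cone such that the system $b - Ax \in K$ is feasible. Let $F_{\min}$ be the minimal cone of this system, let $L = \{ y \in Y : A^*y = 0, \ \langle b, y\rangle = 0\}$, let $\ell_K$ be the length of the longest chain of faces in $K$, and let $\ell = \min\{\ell_K - 1, \dim L\}$. Suppose that the facial reduction algorithm finds $y_0, y_1, \dots$ and corresponding faces $F_0, F_1, \dots$. Then the following hold. (1) $F_{\min} \subseteq F_i$ for $i = 0, 1, \dots$ (2) After a sufficiently large number of reducing iterations the algorithm finds $F_{\min} = F_t$ in some iteration $t$. Furthermore, $F_{\min} = F_i$ holds for all $i \geq t$. (3) The number of reducing iterations in the facial reduction algorithm is at most $\ell$.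
   Context: The facial reduction algorithm is the following: set $y_0 = 0$, $F_0 = K$; then for $i = 1, 2, \dots$ repeat: choose $y_i \in L \cap F_{i-1}^*$ (any choice is allowed, even $y_i = 0$) and let $F_i = F_{i-1} \cap y_i^\perp$. Iteration $i$ is called reducing if $F_i \subsetneq F_{i-1}$. For a set $C$, $C^\perp$ is the orthogonal complement of its linear span; $y^\perp = \{y\}^\perp$. For a cone $C$, $C^* = \{ z : \langle z, x\rangle \ge 0 \ \forall x \in C\}$ is its dual cone. $A^*$ is the adjoint of $A$. A convex subset $F$ of a convex set $C$ is a face of $C$ if $x_1, x_2 \in C$ and $(x_1,x_2)\cap F \ne \emptyset$ imply $x_1, x_2 \in F$, where $(x_1,x_2)$ is the open line segment. The minimal cone $F_{\min}$ of the feasible system $b - Ax \in K$ is the unique face of $K$ that contains $b - A\bar{x}$ in its relative interior, where $\bar x$ is a point in the relative interior of the feasible set $\{x : b - Ax \in K\}$. The length of a chain of faces is the number of (nonempty) faces in a strictly increasing chain of faces of $K$ (e.g. $\ell_K = n+1$ for the cone of $n\times n$ positive semidefinite matrices). *)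

(* Defs.v *)
From HB Require Import structures.
From mathcomp Require Import all_boot all_order all_algebra.
From mathcomp Require Import all_classical all_reals all_analysis.
Set Implicit Arguments.
Unset Strict Implicit.
Unset Printing Implicit Defensive.
Import Order.TTheory GRing.Theory Num.Theory.
Import numFieldNormedType.Exports.
Local Open Scope classical_set_scope.
Local Open Scope ring_scope.

(* A Euclidean space is a finite dimensional real inner product space whose
   norm, hence topology, is the one induced by the inner product. *)
HB.structure Definition NormedVector (R : realType) :=
  {V of NormedModule R V & Vector R V}.

HB.mixin Record NormedVector_isEuclidean (R : realType) V
    & NormedVector R V := {
  inner : {dot V for (@idfun R)} ;
  sqr_norm_inner : forall x : V, `|x| ^+ 2 = inner x x
}.

#[short(type="euclideanType")]
HB.structure Definition Euclidean (R : realType) :=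
  {V of NormedVector R V & NormedVector_isEuclidean R V}.

Notation "''[' u , v ]" := (inner u v) (format "''[' u ,  v ]") : ring_scope.

Section Convexity.
Variables (R : realType) (V : euclideanType R).
Implicit Types (C F K : set V).

Definition convex_cone C :=
  convex_set C /\ forall (t : R) x, 0 <= t -> C x -> C (t *: x).

Definition dual_cone C : set V := [set z | forall x, C x -> 0 <= '[z, x]].

Definition orthocomp (U : {vspace V}) : set V :=
  [set z | forall u, u \in U -> '[u, z] = 0].

Definition open_segment (x1 x2 : V) : set V :=
  [set t *: x1 + (1 - t) *: x2 | t in [set t : R | 0 < t < 1]].

(* The empty set is a face of C. *)
Definition is_face F C :=
  [/\ F `<=` C, convex_set F
    & forall x1 x2, C x1 -> C x2 -> open_segment x1 x2 `&` F !=set0 ->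
        F x1 /\ F x2].

Definition affine_hull C : set V :=
  [set z | exists n (c : 'I_n -> R) (p : 'I_n -> V),
     [/\ forall i, C (p i), \sum_i c i = 1 & z = \sum_i c i *: p i]].

Definition relative_interior C : set V :=
  [set x | C x /\ within (affine_hull C) (nbhs x) C].

Definition face_chain K n (G : 'I_n -> set V) :=
  (forall i, is_face (G i) K /\ G i !=set0) /\
  (forall i j : 'I_n, (i < j)%N -> G i `<` G j).

Definition longest_face_chain K (l : nat) :=
  (exists G : 'I_l -> set V, face_chain K G) /\
  (forall n (G : 'I_n -> set V), face_chain K G -> (n <= l)%N).

End Convexity.

Section ConicSystem.
Variables (R : realType) (X Y : euclideanType R).
Variables (A : 'Hom(X, Y)) (b : Y) (K : set Y).

Definition is_adjoint (A' : 'Hom(Y, X)) :=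
  forall x y, '[A x, y] = '[x, A' y].

Definition feasible_set : set X := [set x | K (b - A x)].

Definition minimal_cone (F : set Y) :=
  is_face F K /\
  exists2 x, relative_interior feasible_set x & relative_interior F (b - A x).

End ConicSystem.

(* A' is meant to be the adjoint of the map A of the system. *)
Definition reducing_space (R : realType) (X Y : euclideanType R)
    (A' : 'Hom(Y, X)) (b : Y) : {vspace Y} :=
  (lker A' :&: lker (linfun (fun y : Y => '[b, y] : R^o)))%VS.

Lemma mem_reducing_space (R : realType) (X Y : euclideanType R)
    (A' : 'Hom(Y, X)) (b y : Y) :
  y \in reducing_space A' b <-> A' y = 0 /\ '[b, y] = 0.
Proof.
rewrite memv_cap !memv_ker lfunE /=.
by split=> [/andP[/eqP ? /eqP]|[-> ->]]; rewrite ?eqxx.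
Qed.

Section FacialReduction.
Variables (R : realType) (Y : euclideanType R).
Variables (K : set Y) (L : {vspace Y}) (y : nat -> Y).

Fixpoint fr_face (i : nat) : set Y :=
  if i is j.+1 then fr_face j `&` orthocomp <[y i]> else K.

Definition facial_reduction_run :=
  y 0%N = 0 /\
  forall i, y i.+1 \in L /\ dual_cone (fr_face i) (y i.+1).

Definition reducing (i : nat) :=
  (0 < i)%N /\ fr_face i `<` fr_face i.-1.

Definition can_reduce (i : nat) :=
  exists z, [/\ z \in L, dual_cone (fr_face i) z
              & fr_face i `&` orthocomp <[z]> `<` fr_face i].

(* Since a choice such as y_i = 0 never reduces anything, a run may perform as
   few reducing iterations as one likes. This property says that it performs
   as many as it can: as long as some choice would reduce the current face,
   another reducing iteration eventually comes. *)
Definition keeps_reducing :=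
  forall i, can_reduce i -> exists2 j, (i < j)%N & reducing j.

End FacialReduction.

(* Main.v *)
(* If G is a face of K that contains Fmin properly, then the subspace W spanned
   by b and the range of A misses the algebraic relative interior ("core") of
   the cone G: a core point in W could, after adding a multiple of
   s = b - A x with x relatively interior to the feasible set, be rescaled to a
   core point b - A x1 of G, and prolonging the segment from x1 through x
   within the feasible set puts b - A x1, hence all of G, into Fmin. A
   separation argument (M. Riesz' extension theorem) then yields a vector of
   L = W^perp that is nonnegative but not zero on G, i.e. a reducing choice.
   Conversely any y in L that is nonnegative on Fmin vanishes at s, which is
   relatively interior to Fmin, hence on Fmin, so Fmin is never cut. Reducing
   iterations give a strictly decreasing chain of nonempty faces, and linearly
   independent vectors of L: if y_i were in the span of the previous ones,
   F_{i-1} would already be orthogonal to it. *)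
Require Import Defs.
From HB Require Import structures.
From mathcomp Require Import finmap.
From mathcomp Require Import all_boot all_order all_algebra.
From mathcomp Require Import all_classical all_reals all_analysis.
From mathcomp Require Import lra ring.
Set Implicit Arguments.
Unset Strict Implicit.
Unset Printing Implicit Defensive.
Import Order.TTheory GRing.Theory Num.Theory.
Import numFieldNormedType.Exports.
Local Open Scope classical_set_scope.
Local Open Scope ring_scope.

(** Places [x] strictly between [z] and a prolongation beyond [x], as the face property requires. *)
Lemma extend_comb (R : realType) (V : lmodType R) (x z : V) (e : R) : 0 < e ->
  x = (e / (1 + e)) *: z + (1 - e / (1 + e)) *: (x + e *: (x - z)).
Proof.
move=> e0; have e1 : 1 + e != 0 by rewrite gt_eqF// addr_gt0.
have -> : 1 - e / (1 + e) = (1 + e)^-1 by field.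
have -> : x + e *: (x - z) = (1 + e) *: x - e *: z.
  by rewrite scalerBr addrA scalerDl scale1r.
by rewrite scalerBr !scalerA mulVf// scale1r [_ / _]mulrC addrC subrK.
Qed.

(** * Orthogonal projection and relative interiors *)

Section Euclidean.
Variables (R : realType) (V : euclideanType R).
Implicit Types (r u v x y z : V) (E W : {vspace V}) (C F G K : set V).

Lemma innerC u v : '[u, v] = '[v, u].
Proof. by rewrite hermC expr0 mul1r. Qed.

Lemma inner_gt0 x : x != 0 -> 0 < '[x, x].
Proof. by move=> x0; rewrite -sqr_norm_inner exprn_gt0// normr_gt0. Qed.

Lemma orthogonal_projection E v :
  exists2 p, p \in E & forall u, u \in E -> '[v - p, u] = 0.
Proof.
rewrite -(span_basis (vbasisP E)).
elim: (tval (vbasis E)) v => [|x X IH] v.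
  by exists 0 => [|u]; rewrite span_nil ?mem0v// memv0 => /eqP->; rewrite linear0r.
have [q qX qP] := IH x; have [p pX pP] := IH v.
(* Gram-Schmidt on a list that need not be free: [n] is zero when [x] depends on [X], and then so is
   [t]. *)
pose n := x - q; pose t := '[v, n] / '[n, n].
have sX u : u \in <<X>>%VS -> u \in <<x :: X>>%VS.
  by rewrite span_cons; apply/subvP/addvSr.
have nxX : n \in <<x :: X>>%VS.
  apply: memvB; last exact: sX.
  exact/memv_span/mem_head.
exists (p + t *: n) => [|u]; first exact/memvD/memvZ/nxX/sX.
have -> : v - (p + t *: n) = (v - p) - t *: n by rewrite opprD addrA.
have orthX w : w \in <<X>>%VS -> '[v - p - t *: n, w] = 0.
  by move=> wX; rewrite linearBl linearZl_LR /= pP// qP// mulr0 subr0.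
have orthn : '[v - p - t *: n, n] = 0.
  rewrite linearBl linearZl_LR /= linearBl /= -/n (innerC p) qP// subr0.
  rewrite /t; have [->|n0] := eqVneq n 0; first by rewrite !linear0r subrr.
  by rewrite divfK ?subrr// gt_eqF// inner_gt0.
rewrite span_cons => /memv_addP[_ /vlineP[k ->] [w wX ->]].
have -> : k *: x + w = k *: n + (k *: q + w).
  by rewrite addrA -scalerDr subrK.
by rewrite linearDr linearZr_LR /= orthn orthX ?memvD ?memvZ// mulr0 addr0.
Qed.

Lemma convex_comb C (t : R) u v : convex_set C -> C u -> C v ->
  0 <= t -> t <= 1 -> C (t *: u + (1 - t) *: v).
Proof.
move=> cC Cu Cv t0 t1.
have := cC u v (Itv01 t0 t1); rewrite !inE; exact.
Qed.

Lemma convex_setP C :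
  (forall (t : R) u v, C u -> C v -> 0 < t -> t < 1 -> C (t *: u + (1 - t) *: v)) ->
  convex_set C.
Proof.
move=> CP; apply/convex_setW => u v; rewrite !inE => Cu Cv k k0 k1.
by rewrite inE; exact: CP.
Qed.

Lemma convex_coneD C u v : convex_cone C -> C u -> C v -> C (u + v).
Proof.
move=> [cC sC] Cu Cv.
have := sC 2 _ _ (@convex_comb C 2^-1 u v cC Cu Cv _ _).
have -> : 1 - 2^-1 = 2^-1 :> R by lra.
rewrite -scalerDr scalerA divff ?pnatr_eq0// scale1r; apply => //; lra.
Qed.

Lemma relative_interior_extend C x z : relative_interior C x -> C z ->
  exists2 e : R, 0 < e & C (x + e *: (x - z)).
Proof.
move=> [Cx] /nbhs_ballP[e /= e0 eC] Cz.
(* Bounds the displacement by [e / 2]; the added 1 avoids dividing by zero when [x = z]. *)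
pose d := e / 2 / (1 + `|x - z|).
have n0 : 0 < 1 + `|x - z| by rewrite ltr_pwDl.
have d0 : 0 < d by rewrite !divr_gt0.
exists d => //; apply: eC.
  rewrite -ball_normE /= opprD addrA subrr add0r normrN normrZ gtr0_norm//.
  have dE : d * (1 + `|x - z|) = e / 2 by rewrite /d divfK ?gt_eqF.
  suff : d * `|x - z| < e by [].
  by lra.
(* The prolonged point is an affine combination of [x] and [z] with weights [1 + d] and [- d]. *)
exists 2%N, (fun i => if i == 0 then 1 + d else - d), (fun i => if i == 0 then x else z).
split=> [i|| ]; first by case: ifP.
  by rewrite !big_ord_recl big_ord0 /= addr0 addrK.
by rewrite !big_ord_recl big_ord0 /= addr0 scalerDl scale1r scalerBr scaleNr addrA.
Qed.

(** * Algebraic relative interior of a convex cone *)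

(** For a convex cone this is the interior relative to its span: only steps against elements of the
    cone are tested, since steps along them stay inside. *)
Definition cone_core C r :=
  C r /\ forall z, C z -> exists2 e : R, 0 < e & C (r - e *: z).

Lemma cone_coreD C r c : convex_cone C -> cone_core C r -> C c ->
  cone_core C (c + r).
Proof.
move=> cC [Cr rP] Cc; split=> [|z /rP[e e0 Ce]]; first exact: convex_coneD.
by exists e => //; rewrite -addrA; apply: convex_coneD.
Qed.

Lemma cone_coreZ C r (t : R) : convex_cone C -> 0 < t -> cone_core C r ->
  cone_core C (t *: r).
Proof.
move=> [_ sC] t0 [Cr rP]; split=> [|z /rP[e e0 Ce]]; first exact/sC/Cr/ltW.
exists (t * e); first exact: mulr_gt0.
by rewrite -scalerA -scalerBr; apply: sC => //; exact: ltW.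
Qed.

Lemma codim_add_line E v : v \notin E ->
  (\dim {: V} - \dim (E + <[v]>) < \dim {: V} - \dim E)%N.
Proof.
move=> vE; have EvE : (\dim E < \dim (E + <[v]>))%N.
  rewrite ltn_neqAle dimvS ?addvSl// andbT; apply: contra vE => /eqP dimE.
  have /eqP -> : E == (E + <[v]>)%VS by rewrite eqEdim addvSl/= dimE.
  exact: subvP (addvSr _ _) _ (memv_line v).
exact/ltn_sub2l/EvE/(leq_trans EvE)/dimvS/subvf.
Qed.

(** If some [v] of the cone lies outside [E], then [r + v] has room in all directions of [E +
    <[v]>], so the codimension of [E] drops; once [E] contains the cone, [r] is a core point. *)
Lemma cone_core_grow C E r : convex_cone C -> C r ->
  (forall z, z \in E -> exists2 e : R, 0 < e & C (r - e *: z)) ->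
  exists r', cone_core C r'.
Proof.
move=> cC; have [n] := ubnP (\dim {: V} - \dim E).
elim: n => // n IH in E r *; rewrite ltnS => En Cr rP.
have [CE|] := pselect (forall z, C z -> z \in E).
  by exists r; split=> // z /CE/rP.
move=> /existsNP[v /not_implyP[Cv /negP vE]].
apply: (IH (E + <[v]>)%VS (r + v)).
- exact: leq_trans (codim_add_line vE) En.
- exact: convex_coneD.
move=> _ /memv_addP[z /rP[e e0 Ce] [_ /vlineP[k ->] ->]].
(* The first bound keeps [r - d *: z] in the cone; the second gives [d * k <= 1], leaving a
   nonnegative multiple of [v]. *)
have m0 : 0 < Num.min e (1 + `|k|)^-1.
  by rewrite lt_min e0 invr_gt0 ltr_pwDl.
exists (Num.min e (1 + `|k|)^-1) => //.
set d := Num.min _ _ in m0 *.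
have de : d <= e by rewrite ge_min lexx.
have dk : d * k <= 1.
  have /ler_pM2r H : 0 < 1 + `|k| by rewrite ltr_pwDl.
  have : d <= (1 + `|k|)^-1 by rewrite ge_min lexx orbT.
  rewrite -H mulVf ?gt_eqF ?ltr_pwDl// => dk; apply: le_trans dk.
  rewrite ler_pM2l//; have := ler_norm k; lra.
have -> : r + v - d *: (z + k *: v) = (r - d *: z) + (1 - d * k) *: v.
  by rewrite scalerDr opprD addrACA scalerBl scale1r scalerA.
apply: convex_coneD => //; last by apply: cC.2 => //; rewrite subr_ge0.
have -> : r - d *: z = (d / e) *: (r - e *: z) + (1 - d / e) *: r.
  rewrite scalerBr scalerA divfK ?gt_eqF// addrAC -scalerDl.
  by rewrite addrCA subrr addr0 scale1r.
apply: convex_comb => //; first exact: cC.1.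
  by rewrite divr_ge0// ltW.
by rewrite ler_pdivrMr// mul1r.
Qed.

Lemma cone_core_ex C : convex_cone C -> C !=set0 -> exists r, cone_core C r.
Proof.
move=> cC [x Cx]; apply: (@cone_core_grow C 0%VS x) => // z.
by rewrite memv0 => /eqP ->; exists 1 => //; rewrite scaler0 subr0.
Qed.

(** * Extension of nonnegative functionals and separation *)

(** Adding to [y] a multiple of the component of [v] orthogonal to [E] adjusts the value at [v] and
    none on [E]. *)
Lemma inner_extend E y v (a : R) : v \notin E ->
  exists y', (forall u, u \in E -> '[y', u] = '[y, u]) /\ '[y', v] = a.
Proof.
move=> vE; have [p pE pP] := orthogonal_projection E v.
pose n := v - p.
have n0 : n != 0 by rewrite subr_eq0; apply: contraNneq vE => ->.
have nv : '[n, v] = '[n, n].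
  by rewrite -[X in '[n, X] = _](subrK p) -/n linearDr /= (pP p pE) addr0.
exists (y + ((a - '[y, v]) / '[n, n]) *: n); split=> [u uE|].
  by rewrite linearDl linearZl_LR /= (pP u uE) mulr0 addr0.
rewrite linearDl linearZl_LR /= nv divfK ?gt_eqF ?inner_gt0//.
by rewrite addrC subrK.
Qed.

(** The value at [v] must be at least [- '[y, u]] when [u + v] is in the cone and at most ['[y, u]]
    when [u - v] is. Adding two such points shows the bounds compatible, so the supremum of the
    lower ones serves; the core point in [E] makes it finite. *)
Lemma nonneg_functional_extend_line C E r y v :
  convex_cone C -> cone_core C r -> r \in E ->
  (forall u, u \in E -> C u -> 0 <= '[y, u]) -> C v -> v \notin E ->
  exists y', (forall u, u \in E -> '[y', u] = '[y, u]) /\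
    (forall u, u \in (E + <[v]>)%VS -> C u -> 0 <= '[y', u]).
Proof.
move=> cC [Cr rP] rE yE Cv vE.
pose S := [set - '[y, u] | u in [set u | u \in E /\ C (u + v)]].
have [e e0 Ce] := rP v Cv.
have Sle u : u \in E -> C (u - v) -> ubound S '[y, u].
  move=> uE Cuv _ [w [wE Cwv] <-].
  rewrite -subr_ge0 opprK -linearDr /=; apply: yE; first exact: memvD.
  have -> : u + w = (u - v) + (w + v) by rewrite addrACA addNr addr0.
  exact: convex_coneD.
have S0 : S !=set0.
  by exists (- '[y, 0]), 0 => //; split; rewrite ?mem0v ?add0r.
have Sb : has_ubound S.
  exists '[y, e^-1 *: r]; apply: Sle; first exact: memvZ.
  have -> : e^-1 *: r - v = e^-1 *: (r - e *: v).
    by rewrite scalerBr scalerA mulVf ?gt_eqF// scale1r.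
  by apply: cC.2 => //; rewrite invr_ge0 ltW.
have [y' [y'E y'v]] := inner_extend y (sup S) vE.
exists y'; split=> // _ /memv_addP[u uE [_ /vlineP[k ->] ->]] Cuk.
rewrite linearDr linearZr_LR /= y'E// y'v.
(* Dividing by the absolute value of [k] reduces to coefficient 1, a lower bound in [S], or -1, an
   upper bound from [Sle]. *)
have [k0|k0|k0] := ltgtP k 0; last first.
- by move: Cuk; rewrite k0 scale0r addr0 mul0r addr0; exact: yE.
- rewrite -[leRHS]divr1 -(@divff _ k) ?gt_eqF//.
  have : - '[y, k^-1 *: u] <= sup S.
    apply: ub_le_sup => //; exists (k^-1 *: u) => //; split; first exact: memvZ.
    have -> : k^-1 *: u + v = k^-1 *: (u + k *: v).
      by rewrite scalerDr scalerA mulVf ?gt_eqF// scale1r.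
    by apply: cC.2 => //; rewrite invr_ge0 ltW.
  rewrite linearZr_LR /= => le_S; rewrite divff ?gt_eqF// divr1.
  by rewrite addrC -lerBlDr sub0r mulrC -ler_pdivrMr// mulNr mulrC.
have nk0 : 0 < - k by rewrite oppr_gt0.
have : sup S <= '[y, (- k)^-1 *: u].
  apply: sup_le_ub => //; apply: Sle; first exact: memvZ.
  have -> : (- k)^-1 *: u - v = (- k)^-1 *: (u + k *: v).
    by rewrite scalerDr scalerA invrN mulNr mulVf ?lt_eqF// scaleN1r.
  by apply: cC.2 => //; rewrite invr_ge0 ltW.
rewrite linearZr_LR /= mulrC ler_pdivlMr// mulrN => le_S.
by rewrite -subr_ge0 opprK mulrC in le_S.
Qed.

(* M. Riesz' extension theorem. *)
Lemma nonneg_functional_extend C E r y :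
  convex_cone C -> cone_core C r -> r \in E ->
  (forall u, u \in E -> C u -> 0 <= '[y, u]) ->
  exists y', (forall u, u \in E -> '[y', u] = '[y, u]) /\ dual_cone C y'.
Proof.
move=> cC rC; have [n] := ubnP (\dim {: V} - \dim E).
elim: n => // n IH in E y *; rewrite ltnS => En rE yE.
have [CE|] := pselect (forall z, C z -> z \in E).
  by exists y; split=> // z Cz; apply: yE => //; exact: CE.
move=> /existsNP[v /not_implyP[Cv /negP vE]].
have [y' [y'E y'P]] := nonneg_functional_extend_line cC rC rE yE Cv vE.
have sE u : u \in E -> u \in (E + <[v]>)%VS by apply/subvP/addvSl.
have [y2 [y2E y2C]] :=
  IH _ y' (leq_trans (codim_add_line vE) En) (sE _ rE) y'P.
by exists y2; split=> // u uE; rewrite y2E ?y'E// sE.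
Qed.

(** Extend the functional that is 0 on [W] and 1 at a core point [r]. It is nonnegative on the cone
    within [W + <[r]>]: a point [w + k *: r] of the cone with [k < 0] would make [w] a core
    point. *)
Lemma cone_subspace_separation C W :
  convex_cone C -> C !=set0 -> (forall w, w \in W -> ~ cone_core C w) ->
  exists y, [/\ forall w, w \in W -> '[y, w] = 0, dual_cone C y
              & exists2 c, C c & '[y, c] != 0].
Proof.
move=> cC C0 WC; have [r rC] := cone_core_ex cC C0.
have rW : r \notin W by apply/negP => /WC.
have [y [yW yr]] := inner_extend 0 1 rW.
have yW0 w : w \in W -> '[y, w] = 0 by move=> /yW ->; rewrite linear0l.
have rWr : r \in (W + <[r]>)%VS by exact: subvP (addvSr _ _) _ (memv_line r).
have [u|y' [y'E y'C]] := @nonneg_functional_extend C (W + <[r]>)%VS r y cC rC rWr.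
  move=> /memv_addP[w wW [_ /vlineP[k ->] ->]] Cu.
  rewrite linearDr linearZr_LR /= yW0// yr mulr1 add0r leNgt; apply/negP => k0.
  apply: (WC _ wW); have -> : w = (- k)  *: r + (w + k *: r).
    by rewrite addrCA -scalerDl addNr scale0r addr0.
  rewrite addrC; apply: cone_coreD => //; apply: cone_coreZ => //.
  by rewrite oppr_gt0.
exists y'; split=> // [w wW|].
  by rewrite y'E ?yW0//; apply: subvP wW; exact: addvSl.
by exists r; [exact: rC.1 | rewrite y'E// yr oner_neq0].
Qed.

(** * Faces of a cone *)

(** A core point of [G] is a proper convex combination of any [z] in [G] and a point of [G], so a
    face containing it absorbs [z]. *)
Lemma face_sub K F G p : convex_cone G -> G `<=` K -> is_face F K -> cone_core G p ->
  F p -> G `<=` F.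
Proof.
move=> cG GK [_ cF FK] [Gp pP] Fp z Gz.
have [e e0 Ge] := pP z Gz.
(* The cap [2^-1] keeps [1 - t] positive, so that [q] can be divided by it. *)
pose t := Num.min e 2^-1.
have t0 : 0 < t by rewrite lt_min e0 invr_gt0 ltr0n.
have t1 : 0 < 1 - t.
  have : t <= 2^-1 by rewrite ge_min lexx orbT.
  by lra.
pose q := p - t *: z.
have Gq : G q.
  have -> : q = (p - e *: z) + (e - t) *: z.
    by rewrite scalerBl addrA subrK.
  apply: convex_coneD => //; apply: cG.2 => //.
  by rewrite subr_ge0 ge_min lexx.
have [| | |Fx1 _ //] := FK z ((1 - t)^-1 *: q); first exact: GK.
  by apply: GK; apply: cG.2 => //; rewrite invr_ge0 ltW.
exists p; split=> //; exists t; first by rewrite /= t0 -subr_gt0.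
by rewrite scalerA divff ?gt_eqF// scale1r addrC subrK.
Qed.

Lemma orthocomp_lineP z c : orthocomp <[z]> c <-> '[z, c] = 0.
Proof.
split=> [zc|zc u /vlineP[k ->]]; first exact/zc/memv_line.
by rewrite linearZl_LR /= zc mulr0.
Qed.

Lemma convex_cap_orthocomp C z : convex_set C ->
  convex_set (C `&` orthocomp <[z]>).
Proof.
move=> cC; apply: convex_setP => t u v [Cu /orthocomp_lineP zu].
move=> [Cv /orthocomp_lineP zv] t0 t1.
split; first by apply: convex_comb => //; exact: ltW.
by apply/orthocomp_lineP; rewrite linearDr !linearZr_LR /= zu zv !mulr0 addr0.
Qed.

(** A linear functional that is nonnegative at both ends of a segment and vanishes inside it
    vanishes at both ends. *)
Lemma face_cap_orthocomp K G z : is_face G K -> dual_cone G z ->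
  is_face (G `&` orthocomp <[z]>) K.
Proof.
move=> [GK cG faceG] zG; split.
- by move=> c [/GK].
- exact: convex_cap_orthocomp.
move=> x1 x2 K1 K2 [_ [[t /andP[t0 t1] <-] [Gx /orthocomp_lineP]]].
have [|G1 G2] := faceG x1 x2 K1 K2.
  by exists (t *: x1 + (1 - t) *: x2); split=> //; exists t => //; exact/andP.
rewrite linearDr !linearZr_LR /= => z12.
have := zG _ G1; have := zG _ G2 => z2 z1.
split; split=> //; apply/orthocomp_lineP; nra.
Qed.

Lemma convex_cone_cap_orthocomp G z : convex_cone G ->
  convex_cone (G `&` orthocomp <[z]>).
Proof.
move=> [cG sG]; split; first exact: convex_cap_orthocomp.
move=> t c t0 [Gc /orthocomp_lineP zc]; split; first exact: sG.
by apply/orthocomp_lineP; rewrite linearZr_LR /= zc mulr0.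
Qed.

End Euclidean.

(** * The minimal cone and reducing directions *)

Section ConicSystem.
Variables (R : realType) (X Y : euclideanType R).
Variables (A : 'Hom(X, Y)) (A' : 'Hom(Y, X)) (b : Y) (K : set Y).
Hypothesis adjA : is_adjoint A A'.
Implicit Types G : set Y.

Lemma reducing_space_orth z x : z \in reducing_space A' b -> '[z, b - A x] = 0.
Proof.
rewrite mem_reducing_space => -[A'z bz].
by rewrite linearBr /= [X in X - _]innerC bz innerC adjA A'z linear0r subrr.
Qed.

Lemma range_orth_reducing_space z :
  (forall w, w \in (limg A + <[b]>)%VS -> '[z, w] = 0) ->
  z \in reducing_space A' b.
Proof.
move=> zP; rewrite mem_reducing_space; split.
  (* The value of [z] at [A (A' z)] is the squared norm of [A' z]. *)
  apply/eqP; apply/negPn/negP => /inner_gt0; rewrite -adjA innerC zP ?ltxx//.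
  exact: subvP (addvSl _ _) _ (memv_img _ (memvf _)).
by rewrite innerC zP//; exact: subvP (addvSr _ _) _ (memv_line b).
Qed.

Lemma minimal_cone_reducible Fmin G :
  minimal_cone A b K Fmin -> convex_cone G -> is_face G K -> Fmin `<=` G ->
  ~ G `<=` Fmin ->
  exists z, [/\ z \in reducing_space A' b, dual_cone G z
              & exists2 c, G c & '[z, c] != 0].
Proof.
move=> [faceF [xb riX riF]] cG [GK _ _] FG GF.
have Fs : Fmin (b - A xb) by exact: riF.1.
have [||z [zW zG zc]] := @cone_subspace_separation _ _ G (limg A + <[b]>)%VS cG.
- by exists (b - A xb); exact: FG.
- move=> _ /memv_addP[_ /memv_imgP[x _ ->] [_ /vlineP[k ->] ->]] coreW.
  (* This [m] makes [k + m] positive; dividing [m *: (b - A xb) + (A x + k *: b)] by it gives the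
     form [b - A x1]. *)
  apply: GF; pose m := 1 + `|k|.
  have m0 : 0 < m by rewrite ltr_pwDl.
  have km0 : 0 < k + m by rewrite /m; have := ler_norm (- k); rewrite normrN; lra.
  pose x1 := (k + m)^-1 *: (m *: xb - x).
  have core1 : cone_core G (b - A x1).
    have -> : b - A x1 = (k + m)^-1 *: (m *: (b - A xb) + (A x + k *: b)).
      have -> : m *: (b - A xb) + (A x + k *: b) =
          (k + m) *: b - (m *: A xb - A x).
        rewrite scalerBr scalerDl opprB [A x + _]addrC addrACA.
        by rewrite [m *: b + _]addrC [- _ + _]addrC.
      rewrite scalerBr scalerA mulVf ?gt_eqF// scale1r.
      suff -> : A x1 = (k + m)^-1 *: (m *: A xb - A x) by [].
      by rewrite linearZ linearB linearZ.
    apply: cone_coreZ; rewrite ?invr_gt0//; apply: cone_coreD => //.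
    by apply: cG.2; [exact: ltW | exact: FG].
  apply: (face_sub cG GK faceF core1).
  (* Now [x1] is feasible, so the segment from it extends beyond [xb]; the face property of [Fmin]
     at [b - A xb] then captures [b - A x1]. *)
  have [e e0 Ke] := relative_interior_extend riX (GK _ core1.1).
  have e1 : 0 < 1 + e by rewrite addr_gt0.
  have [_ _ FK] := faceF.
  have [| | |Fx1 _ //] := FK (b - A x1) (b - A (xb + e *: (xb - x1))).
  + by apply: GK; exact: core1.1.
  + exact: Ke.
  exists (b - A xb); split=> //; exists (e / (1 + e)).
    by rewrite /= divr_gt0//= ltr_pdivrMr// mul1r ltrDr.
  have -> : A (xb + e *: (xb - x1)) = A xb + e *: (A xb - A x1).
    by rewrite linearD linearZ linearB.
  have -> : b - (A xb + e *: (A xb - A x1)) =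
      (b - A xb) + e *: ((b - A xb) - (b - A x1)).
    rewrite opprD addrA -scalerN !opprB; congr (_ + _ *: _).
    by rewrite [RHS]addrC subrKA.
  by rewrite -extend_comb.
- by exists z; split=> //; exact: range_orth_reducing_space.
Qed.

(** Prolonging from [c] through [b - A xb] inside [Fmin] reaches a point where [z] has the value [-
    e * '[z, c]], which must be nonnegative. *)
Lemma minimal_cone_orth Fmin z : minimal_cone A b K Fmin ->
  z \in reducing_space A' b -> dual_cone Fmin z -> Fmin `<=` orthocomp <[z]>.
Proof.
move=> [_ [xb _ riF]] zL zF c Fc; apply/orthocomp_lineP.
have := reducing_space_orth xb zL; move: (b - A xb) riF => s riF zs.
have [e e0 /zF] := relative_interior_extend riF Fc.
rewrite linearDr linearZr_LR linearBr /= zs.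
have := zF c Fc; nra.
Qed.

End ConicSystem.

(** * Faces and reducing iterations of a run *)

Section Run.
Variables (R : realType) (Y : euclideanType R).
Variables (K : set Y) (L : {vspace Y}) (y : nat -> Y).
Hypothesis run : facial_reduction_run K L y.
Let F := fr_face K y.

Lemma fr_face_anti i j : (i <= j)%N -> F j `<=` F i.
Proof.
move=> /subnK <-; elim: (j - i)%N => [//|n IH]; rewrite addSn => c [Fc _].
exact: IH.
Qed.

Lemma fr_face_convex_cone i : convex_cone K -> convex_cone (F i).
Proof. by move=> cK; elim: i => [//|i IH]; exact: convex_cone_cap_orthocomp. Qed.

Lemma fr_face_face i : convex_cone K -> is_face (F i) K.
Proof.
move=> [cK _]; elim: i => [|i IH]; last exact: face_cap_orthocomp (run.2 i).2.
split=> // x1 x2 K1 K2 _; by split.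
Qed.

Lemma fr_face_orth i j c : (0 < j)%N -> (j <= i)%N -> F i c -> '[y j, c] = 0.
Proof. by case: j => // j _ /fr_face_anti Fij /Fij[_ /orthocomp_lineP]. Qed.

Lemma reducing_proper i j : reducing K y j -> (i < j)%N -> F j `<` F i.
Proof.
case: j => [[//]|j [_ [FS Fj]]]; rewrite ltnS => ij.
split; first exact/fr_face_anti/leqW.
by move=> Fi; apply: Fj; apply: subset_trans Fi; exact: fr_face_anti.
Qed.

(** Decreasing order puts the latest iteration at the head, so [free_cons] compares it with earlier
    choices only. *)
Lemma reducing_free s : sorted gtn s -> (forall i, i \in s -> reducing K y i) ->
  free [seq y i | i <- s].
Proof.
elim: s => [|i s IH] /=; first by rewrite nil_free.
move=> pis red; rewrite free_cons IH ?(path_sorted pis)//; last first.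
  by move=> j js; apply: red; rewrite in_cons js orbT.
rewrite andbT; apply/negP => yspan.
have gts j : j \in s -> (j < i)%N.
  by have /allP := order_path_min (rev_trans ltn_trans) pis; apply.
have := red i (mem_head _ _); case: i yspan gts {IH pis} red => [_ _ _ [//]|i].
move=> yspan gts red [_ [_ Fi]]; apply: Fi => c Fc; split=> //.
apply/orthocomp_lineP; apply/eqP; rewrite innerC.
(* The vectors orthogonal to [c] form a subspace, so it suffices to check the earlier choices that
   span. *)
have : y i.+1 \in lker (linfun (fun u : Y => '[c, u] : R^o)).
  apply: subvP yspan; apply/span_subvP => _ /mapP[j js ->].
  rewrite memv_ker lfunE /=; apply/eqP; rewrite innerC.
  apply: (@fr_face_orth i) => //; last by rewrite -ltnS gts.
  by have [] := red j _; rewrite // in_cons js orbT.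
by rewrite memv_ker lfunE.
Qed.

Lemma reducing_size_dim s : sorted gtn s ->
  (forall i, i \in s -> reducing K y i) -> (size s <= \dim L)%N.
Proof.
move=> ss red; have := reducing_free ss red.
rewrite /free size_map => /eqP <-; apply/dimvS/span_subvP => _ /mapP[j /red[j0 _] ->].
by case: j j0 => // j _; exact: (run.2 j).1.
Qed.

Lemma reducing_size_chain l s : convex_cone K -> (forall i, F i !=set0) ->
  (forall n (G : 'I_n -> set Y), face_chain K G -> (n <= l)%N) ->
  sorted gtn s -> (forall i, i \in s -> reducing K y i) -> (size s <= l - 1)%N.
Proof.
move=> cK F0 hl ss red.
suff : (size s < l)%N by case: l {hl} => // l; rewrite subn1.
(* Past the end, [nth] returns 0 and adds [F 0 = K] on top: the chain has one face more than there
   are iterations. *)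
apply: (hl _ (fun i : 'I_(size s).+1 => F (nth 0%N s i))); split=> [i|i j ij].
  by split => //; exact: fr_face_face.
have is_ : (i < size s)%N by rewrite (leq_trans ij)// -ltnS.
apply: reducing_proper; first exact/red/mem_nth.
have [js|js] := ltnP j (size s).
  exact: (sorted_ltn_nth (rev_trans ltn_trans)).
by rewrite nth_default//; have [] := red _ (mem_nth 0%N is_).
Qed.

End Run.

(** * Counting the reducing iterations and reaching the minimal cone *)

(** An infinite set cannot satisfy the bound: it has finite subsets of more than [N] elements, which
    can be sorted into lists. *)
Lemma card_le_II_sorted (S : set nat) N :
  (forall s, sorted gtn s -> (forall i, i \in s -> S i) -> (size s <= N)%N) ->
  (S #<= `I_N)%card.
Proof.
move=> SN.
have fsN (X : {fset nat}) : [set` X] `<=` S -> (#|` X| <= N)%N.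
  move=> XS; rewrite -(size_sort geq); apply: SN => [|i].
    by rewrite gtn_sorted_uniq_geq sort_uniq fset_uniq sort_sorted//.
  by rewrite mem_sort => /XS.
have [finS|infS] := pselect (finite_set S).
  have [n Sn] := finS; rewrite (card_le_eql Sn) card_le_II -(card_fset_set Sn); apply: fsN.
  by rewrite fset_setK.
have [X XS NX] := infinite_set_fset N.+1 infS.
by have := leq_trans NX (fsN X XS); rewrite ltnn.
Qed.

Theorem theorem1 (R : realType) (X Y : euclideanType R)
    (A : 'Hom(X, Y)) (A' : 'Hom(Y, X)) (b : Y) (K Fmin : set Y) (lK : nat)
    (y : nat -> Y)
    (L := reducing_space A' b) (F := fr_face K y)
    (hA' : is_adjoint A A')
    (hKclosed : closed K) (hKcone : convex_cone K)
    (hfeas : feasible_set A b K !=set0)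
    (hFmin : minimal_cone A b K Fmin)
    (hlK : longest_face_chain K lK)
    (hrun : facial_reduction_run K L y) :
  [/\ (forall i : nat, Fmin `<=` F i),
      (keeps_reducing K L y -> exists t : nat, Fmin = F t) /\
      (forall t : nat, Fmin = F t -> forall i : nat, (t <= i)%N -> Fmin = F i)
    & ([set i : nat | reducing K y i] #<= `I_(minn (lK - 1) (\dim L)))%card].
Proof.
have FminF i : Fmin `<=` F i.
  elim: i => [|i IH] /=; first by case: hFmin => -[].
  have [yL yF] := hrun.2 i.
  have yFmin : dual_cone Fmin (y i.+1) by move=> c /IH /yF.
  by move=> c Fc; split; [exact: IH | exact: (minimal_cone_orth hA' hFmin yL yFmin)].
have F0 i : F i !=set0.
  by case: hFmin => _ [xb _ riF]; exists (b - A xb); exact/FminF/riF.1.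
have card_red : ([set i : nat | reducing K y i] #<= `I_(minn (lK - 1) (\dim L)))%card.
  apply: card_le_II_sorted => s ss red; rewrite leq_min.
  rewrite (reducing_size_chain hrun hKcone F0 hlK.2 ss red).
  exact: (reducing_size_dim hrun ss red).
split=> //; split=> [keeps|t Ft i ti]; last first.
  by apply/seteqP; split=> //; rewrite Ft; exact: fr_face_anti.
(* If [Fmin] is never reached, every face can be reduced, so reducing iterations come without end,
   against the bound [\dim L]. *)
apply: contrapT => Fneq.
have next i : exists2 j, (i < j)%N & reducing K y j.
  apply: keeps.
  have FFmin : ~ F i `<=` Fmin.
    by move=> FF; apply: Fneq; exists i; apply/seteqP.
  have [z [zL zF [c Fc zc]]] := minimal_cone_reducible hA' hFmin
    (fr_face_convex_cone y i hKcone) (fr_face_face hrun i hKcone) (FminF i) FFmin.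
  exists z; split=> //; split; first exact: subIsetl.
  by move=> /(_ c Fc)[_ /orthocomp_lineP /eqP]; exact/negP.
have long n : exists2 s, sorted gtn s /\ (forall i, i \in s -> reducing K y i) & size s = n.
  elim: n => [|n [s [ss red] <-]]; first by exists [::].
  (* [head] is the largest index so far, or 0 for the empty list, so prepending [j] keeps the list
     decreasing. *)
  have [j sj redj] := next (head 0%N s); exists (j :: s) => //.
  split; last by move=> i; rewrite in_cons => /predU1P[->//|/red].
  by case: s ss red sj => //= i s -> _ ->.
have [s [ss red] sE] := long (\dim L).+1.
by have := reducing_size_dim hrun ss red; rewrite sE ltnn.
Qed.
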